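(* Let $d\ge 1$ be an integer and let $n \le 2d + 2^{\gamma(d)}-1$, where $2^{\gamma(d)}$ is the smallest power of $2$ satisfying $2^{\gamma(d)} \geq \rho(d)$ and $\rho$ is the Hurwitz--Radon function. Then any embedding $f\colon \mathbb{R}^d \to \mathbb{R}^n$ inscribes a trapezoid or maps three distinct points to a line.
   Context: Hurwitz--Radon function: write $d$ as the product of an odd number and $2^{4a+b}$ with integers $a\ge 0$ and $0\le b\le 3$; then $\rho(d) := 2^b+8a$. Equivalently, $\rho(d)$ is the largest integer such that there exists a bilinear map $B\colon \mathbb{R}^{\rho(d)}\times\mathbb{R}^d\to\mathbb{R}^d$ that is nonsingular, i.e. $B(x,y)=0$ if and only if $x=0$ or $y=0$. Powers of $2$ include $2^0=1$. Embedding means topological embedding (in particular continuous and injective). The map $f$ inscribes a trapezoid if its image contains the four vertices of a trapezoid, i.e. there are four pairwise distinct points $u_1,v_1,u_2,v_2\in f(\mathbb{R}^d)$, no three of them collinear, and reals $t_1,t_2>0$ with $t_1(u_1-v_1)=t_2(u_2-v_2)$ (parallelograms count as trapezoids). The map $f$ maps three distinct points to a line if there are three distinct points of $\mathbb{R}^d$ whose images under $f$ lie on a common affine line. *)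

(* Defs.v *)
From mathcomp Require Import all_boot all_order all_algebra.
From mathcomp Require Import all_classical all_reals all_analysis.
Import numFieldNormedType.Exports.
Import Order.TTheory GRing.Theory Num.Theory.

Set Implicit Arguments.
Unset Strict Implicit.
Unset Printing Implicit Defensive.

Local Open Scope classical_set_scope.
Local Open Scope ring_scope.

(* For d > 0 the exponent of 2 in d is 4a+b with b <= 3 exactly when
   a = logn 2 d %/ 4 and b = logn 2 d %% 4; see hurwitz_radonE. *)
Definition hurwitz_radon (d : nat) : nat :=
  (2 ^ (logn 2 d %% 4) + 8 * (logn 2 d %/ 4))%N.

Lemma hurwitz_radonE (m a b : nat) : odd m -> (b <= 3)%N ->
  hurwitz_radon (m * 2 ^ (4 * a + b)) = (2 ^ b + 8 * a)%N.
Proof.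
move=> om lb.
have m0 : (0 < m)%N by case: m om.
have l : logn 2 (m * 2 ^ (4 * a + b)) = (a * 4 + b)%N.
  rewrite lognM ?expn_gt0 // pfactorK // logn_coprime ?coprime2n //.
  by rewrite add0n mulnC.
by rewrite /hurwitz_radon l modnMDl divnMDl // modn_small // divn_small ?addn0.
Qed.

(* up_log 2 k is the least e with k <= 2 ^ e. *)
Definition gamma (d : nat) : nat := up_log 2 (hurwitz_radon d).

(* Homeomorphism onto the image: f carries open sets to sets that are open in
   the subspace topology of range f. *)
Definition embedding (S T : topologicalType) (f : S -> T) : Prop :=
  [/\ injective f, continuous f &
      forall U : set S, open U ->
        exists2 V : set T, open V & f @` U = V `&` range f].

Definition affine_line (R : realType) (n : nat) (a v : 'rV[R]_n) :
  set 'rV[R]_n := [set a + t *: v | t in [set: R]].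

Definition collinear (R : realType) (n : nat) (x y z : 'rV[R]_n) : Prop :=
  exists a v : 'rV[R]_n, v != 0 /\
    [/\ affine_line a v x, affine_line a v y & affine_line a v z].

Definition inscribes_trapezoid (R : realType) (d n : nat)
    (f : 'rV[R]_d -> 'rV[R]_n) : Prop :=
  exists u1 v1 u2 v2 : 'rV[R]_n,
    [/\ [/\ range f u1, range f v1, range f u2 & range f v2],
        uniq [:: u1; v1; u2; v2],
        [/\ ~ collinear u1 v1 u2, ~ collinear u1 v1 v2,
            ~ collinear u1 u2 v2 & ~ collinear v1 u2 v2] &
        exists t1 t2 : R,
          [/\ 0 < t1, 0 < t2 & t1 *: (u1 - v1) = t2 *: (u2 - v2)]].

Definition maps_three_to_line (R : realType) (d n : nat)
    (f : 'rV[R]_d -> 'rV[R]_n) : Prop :=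
  exists x y z : 'rV[R]_d,
    uniq [:: x; y; z] /\ collinear (f x) (f y) (f z).

(* Main.v *)
Require Import Defs.
From mathcomp Require Import all_boot all_order all_algebra.
From mathcomp Require Import all_classical all_reals all_analysis.
Import numFieldNormedType.Exports.
From mathcomp Require Import ring lra zify.
Import Order.TTheory GRing.Theory Num.Theory.

Set Implicit Arguments.
Unset Strict Implicit.
Unset Printing Implicit Defensive.

(* If f is a counterexample, the chords f x - f y of distinct pairs of distinct
   points are never parallel.  Describe two pairs of points by v in the unit
   sphere of R^K, K = 2^(gamma d), and w = (low, mid, top) in the unit sphere of
   R^d x R^d x R (chord_comb below), and take the convex combination of the two
   chords with weights (1 + top) / 2 and - (1 - top) / 2.  This is a nowhere zero
   map F into R^n which is odd under w -> - w and under
   (v, low) -> - (v, low).  Such an F does not exist for n <= 2d + K - 1, as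
   (v, low) -> - (v, low) twists the product of the two spheres in such a way
   that the mod 2 obstruction is the binomial coefficient C(d + K - 1, K - 1),
   odd because K divides d.

   The obstruction is computed on cochains mod 2.  For signs S k of the
   coordinates of F, the cochains W k = dS_k u ... u dS_1 satisfy
   W k.+1 = d (S_(k+1) u W k).  The spheres have one cell and its antipode in
   each dimension, each obtained by contracting the previous sphere to a pole
   through M small prisms; by Stokes' formula, the value of W (i + j) on the
   product of an i-cell and a j-cell obeys Pascal's recursion.  The top value is
   odd, so all coordinates of F change sign on some small simplex; let M go to
   infinity. *)

(** * Mod 2 cochains, prism operators and the cells of a sphere *)

Section Cochains.
Variable T : Type.
Implicit Types (phi psi : seq T -> bool) (s t : seq T) (g h k : T -> T).

(* A cochain is evaluated on all ordered tuples of points at once; the empty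
   tuple is the (-1)-simplex of the augmented complex. *)
Definition addc phi psi : seq T -> bool := fun s => phi s (+) psi s.

Definition zeroc : seq T -> bool := fun=> false.

Definition pull g phi : seq T -> bool := fun s => phi (map g s).

Fixpoint coboundary phi s : bool :=
  if s is x :: s' then phi s' (+) coboundary (fun t => phi (x :: t)) s'
  else false.

(** The standard triangulation of the prism between [map g s] and [map h s]: its simplices follow
    [g] up to some vertex, repeat that vertex, then follow [h]. *)
Fixpoint prism g h phi s : bool :=
  if s is x :: s' then
    phi [:: g x, h x & map h s'] (+) prism g h (fun t => phi (g x :: t)) s'
  else false.

Lemma addcE phi psi s : addc phi psi s = phi s (+) psi s.
Proof. by []. Qed.

Lemma addcC phi psi : addc phi psi = addc psi phi.
Proof. by apply: funext => s; rewrite /addc addbC. Qed.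

Lemma addcc phi : addc phi phi = zeroc.
Proof. by apply: funext => s; rewrite /addc addbb. Qed.

Lemma addc0 phi : addc phi zeroc = phi.
Proof. by apply: funext => s; rewrite /addc addbF. Qed.

Lemma addcACA a b c e : addc (addc a b) (addc c e) = addc (addc a c) (addc b e).
Proof. by apply: funext => s; rewrite /addc addbACA. Qed.

Lemma pull_id phi : pull id phi = phi.
Proof. by apply: funext => s; rewrite /pull map_id. Qed.

Lemma pull_nil g phi : pull g phi [::] = phi [::].
Proof. by []. Qed.

Lemma pull_comp g h phi : pull g (pull h phi) = pull (h \o g) phi.
Proof. by apply: funext => s; rewrite /pull map_comp. Qed.

Lemma pullD g phi psi : pull g (addc phi psi) = addc (pull g phi) (pull g psi).
Proof. by []. Qed.

Lemma coboundaryD phi psi :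
  coboundary (addc phi psi) = addc (coboundary phi) (coboundary psi).
Proof.
apply: funext => s; rewrite /addc; elim: s phi psi => [//|x s IH] phi psi /=.
by rewrite IH addbACA.
Qed.

Lemma coboundary0 : coboundary zeroc = zeroc.
Proof. by apply: funext; elim. Qed.

Lemma coboundary_pull g phi : coboundary (pull g phi) = pull g (coboundary phi).
Proof.
apply: funext => s; rewrite /pull; elim: s phi => [//|x s IH] phi /=.
by rewrite (IH (fun t => phi (g x :: t))).
Qed.

Lemma coboundary_seq1 phi x : coboundary phi [:: x] = phi [::].
Proof. exact: addbF. Qed.

Lemma prismD g h phi psi :
  prism g h (addc phi psi) = addc (prism g h phi) (prism g h psi).
Proof.
apply: funext => s; rewrite /addc; elim: s phi psi => [//|x s IH] phi psi /=.
by rewrite IH addbACA.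
Qed.

Lemma pull_prism k g h phi :
  pull k (prism g h phi) = prism (g \o k) (h \o k) phi.
Proof.
apply: funext => s; rewrite /pull; elim: s phi => [//|x s IH] phi /=.
by rewrite (IH (fun t => phi (g (k x) :: t))) map_comp.
Qed.

Lemma prism_pull k g h phi :
  prism g h (pull k phi) = prism (k \o g) (k \o h) phi.
Proof.
apply: funext => s; rewrite /pull; elim: s phi => [//|x s IH] phi /=.
by rewrite (IH (fun t => phi (k (g x) :: t))) map_comp.
Qed.

(** Chain homotopy formula: inner faces of the prism cancel in pairs mod 2, leaving the two ends and
    the prisms over the faces of the base. *)
Lemma prism_coboundary g h phi :
  prism g h (coboundary phi) =
  addc (addc (pull g phi) (pull h phi)) (coboundary (prism g h phi)).
Proof.
apply: funext => s; rewrite /addc /pull.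
elim: s phi => [|x s IH] phi /=; first by rewrite addbb.
have -> : (fun t => phi t (+) coboundary (fun u => phi (g x :: u)) t) =
  addc phi (coboundary (fun u => phi (g x :: u))) by [].
have -> : (fun t => phi [:: g x, h x & map h t] (+)
                    prism g h (fun u => phi (g x :: u)) t) =
  addc (pull h (fun t => phi [:: g x, h x & t]))
       (prism g h (fun u => phi (g x :: u))) by [].
rewrite prismD coboundaryD coboundary_pull /addc /pull IH.
move: (phi (h x :: _)) (phi (g x :: map g s)) (phi (g x :: map h s)) => a b c.
move: (coboundary _ _) (prism g h phi s) (coboundary _ _) => a' b' c'.
by case: a; case: b; case: c; case: a'; case: b'; case: c'.
Qed.

Fixpoint homot (H : nat -> T -> T) m phi : seq T -> bool :=
  if m is a.+1 then addc (homot H a phi) (prism (H a) (H a.+1) phi) else zeroc.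

Lemma homotD H m phi psi :
  homot H m (addc phi psi) = addc (homot H m phi) (homot H m psi).
Proof.
elim: m => [|m IH] /=; first by rewrite addcc.
by rewrite IH prismD addcACA.
Qed.

Lemma pull_homot k H m phi :
  pull k (homot H m phi) = homot (fun a => H a \o k) m phi.
Proof. by elim: m => [//|m IH] /=; rewrite pullD IH pull_prism. Qed.

Lemma homot_pull k H m phi :
  homot H m (pull k phi) = homot (fun a => k \o H a) m phi.
Proof. by elim: m => [//|m IH] /=; rewrite IH prism_pull. Qed.

Lemma homot_nil H m phi : homot H m phi [::] = false.
Proof. by elim: m => [//|m IH] /=; rewrite /addc IH. Qed.

Lemma homot_coboundary H m phi :
  homot H m (coboundary phi) =
  addc (addc (pull (H 0%N) phi) (pull (H m) phi)) (coboundary (homot H m phi)).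
Proof.
elim: m => [|m IH] /=; first by rewrite coboundary0 addcc addc0.
rewrite IH prism_coboundary coboundaryD; apply: funext => s; rewrite /addc.
move: (pull _ _ _) (pull _ _ _) (pull _ _ _) => a b c.
move: (coboundary _ _) (coboundary _ _) => a' b'.
by case: a; case: b; case: c; case: a'; case: b'.
Qed.

Variables (M : nat) (om : T -> T) (H : nat -> nat -> T -> T).

(** Adding the pullback by [om] makes the base of the contraction a cell together with its antipode,
    that is, a whole sphere. *)
Definition suspend j phi :=
  addc (homot (H j) M phi) (pull om (homot (H j) M phi)).

(* Pairing with a cell of dimension j of a sphere with antipode om: H j
   contracts the (j-1)-sphere to the j-th pole. *)
Fixpoint cell j phi : seq T -> bool :=
  if j is i.+1 then cell i (suspend j phi) else pull (H 0%N M) phi.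

Lemma cell_pole phi : cell 0 phi = pull (H 0%N M) phi.
Proof. by []. Qed.

Lemma cellS j phi : cell j.+1 phi = cell j (suspend j.+1 phi).
Proof. by []. Qed.

Lemma suspendD j phi psi :
  suspend j (addc phi psi) = addc (suspend j phi) (suspend j psi).
Proof. by rewrite /suspend homotD pullD addcACA. Qed.

Lemma cellD j phi psi : cell j (addc phi psi) = addc (cell j phi) (cell j psi).
Proof. by elim: j phi psi => [//|j IH] phi psi /=; rewrite suspendD IH. Qed.

Lemma cell0 j : cell j zeroc = zeroc.
Proof. by have := cellD j zeroc zeroc; rewrite !addcc. Qed.

Lemma cell_nil j phi : cell j.+1 phi [::] = false.
Proof.
rewrite /=; have : suspend j.+1 phi [::] = false.
  by rewrite /suspend /addc /pull /= homot_nil.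
elim: j (suspend _ _) => [//|j IH] psi _ /=.
by apply: IH; rewrite /suspend /addc /pull /= homot_nil.
Qed.

Hypothesis om_invol : om \o om = id.
Hypothesis H_start : forall j, H j 0%N = id.
Hypothesis H_end : forall j, H j M \o om = H j M.

Lemma pull_suspend j phi : pull om (suspend j phi) = suspend j phi.
Proof. by rewrite /suspend pullD pull_comp om_invol pull_id addcC. Qed.

(** The far end of the contraction takes the same value on a tuple and on its antipode, hence
    cancels mod 2; only the near ends survive. *)
Lemma suspend_coboundary j phi :
  suspend j (coboundary phi) =
  addc (addc phi (pull om phi)) (coboundary (suspend j phi)).
Proof.
rewrite /suspend homot_coboundary H_start pull_id !pullD pull_comp H_end.
rewrite coboundaryD coboundary_pull; apply: funext => s; rewrite /addc.
move: (phi s) (pull _ _ _) (pull _ _ _) (coboundary _ _) (pull _ _ _).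
by do 5![case].
Qed.

Lemma cell0_coboundary phi : cell 0 (coboundary phi) = coboundary (cell 0 phi).
Proof. by rewrite /= coboundary_pull. Qed.

(** Stokes' formula: the boundary of a cell is the cell one dimension lower plus its antipode. The
    term [coboundary (cell j.+1 phi)] is the boundary in the remaining argument, the other factor of
    a product. Lower boundaries cancel because a suspension is antipodally invariant. *)
Lemma cellS_coboundary j phi :
  cell j.+1 (coboundary phi) =
  addc (coboundary (cell j.+1 phi)) (cell j (addc phi (pull om phi))).
Proof.
elim: j phi => [|j IH] phi; rewrite !(cellS _ phi) cellS suspend_coboundary.
  by rewrite cellD cell0_coboundary addcC.
by rewrite cellD IH pull_suspend addcc cell0 addc0 addcC.
Qed.

Lemma cell_pull_comm k j phi : k \o om = om \o k ->
  (forall i a, k \o H i a = H i a \o k) ->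
  pull k (cell j phi) = cell j (pull k phi).
Proof.
move=> kom kH; elim: j phi => [|j IH] phi /=.
  by rewrite !pull_comp kH.
rewrite IH /suspend pullD pull_comp -kom -pull_comp pull_homot homot_pull.
by under eq_fun do rewrite -kH.
Qed.

(* A reflection rho fixing the j-th pole preserves the j-cell, and one
   exchanging the two j-th poles maps it to its antipode. *)
Lemma cell_reflect rho (b : nat -> bool) j phi :
  rho \o om = om \o rho ->
  rho \o H 0%N M = (if b 0%N then om \o H 0%N M else H 0%N M) ->
  (forall i a, rho \o H i a =
     if b i then om \o H i a \o om \o rho else H i a \o rho) ->
  cell j (pull rho phi) = cell j (if b j then pull om phi else phi).
Proof.
move=> rom r0 rH; elim: j phi => [|j IH] phi /=.
  by rewrite pull_comp r0; case: (b 0%N) => //; rewrite pull_comp.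
set psi := if b j.+1 then pull om phi else phi.
have E : homot (H j.+1) M (pull rho phi) =
    if b j.+1 then pull rho (pull om (homot (H j.+1) M psi))
    else pull rho (homot (H j.+1) M psi).
  rewrite homot_pull; under eq_fun do rewrite rH.
  rewrite /psi; case: (b j.+1); last by rewrite pull_homot.
  by rewrite homot_pull !pull_homot.
have -> : suspend j.+1 (pull rho phi) = pull rho (suspend j.+1 psi).
  rewrite /suspend E; case: (b j.+1); rewrite !pullD !pull_comp.
    (* If the poles are exchanged, the two summands of [suspend] swap. *)
    have -> : (om \o rho) \o om = rho by rewrite -rom -compA om_invol.
    by rewrite addcC.
  by rewrite rom.
(* Exchanges of lower poles have no effect on an antipodally invariant cochain. *)
by rewrite IH pull_suspend if_same.
Qed.

End Cochains.

(** * Locality: cells evaluate cochains on small simplices only *)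

Section Support.
Variable T : eqType.
Implicit Types (phi psi : seq T -> bool) (s t : seq T) (g h k : T -> T).

Definition pairwise_in (r : T -> T -> Prop) s :=
  forall x y, x \in s -> y \in s -> r x y.

Lemma eq_in_prism g h phi psi s :
  (forall t, {subset t <= map g s ++ map h s} -> phi t = psi t) ->
  prism g h phi s = prism g h psi s.
Proof.
elim: s phi psi => [//|x s IH] phi psi eqf /=; congr addb.
  apply: eqf => y; rewrite mem_cat !inE.
  by case/or3P => ->; rewrite ?orbT.
apply: IH => t st; apply: eqf => y; rewrite mem_cat !inE => /orP[->//|/st].
by rewrite mem_cat => /orP[] ->; rewrite ?orbT.
Qed.

Lemma eq_in_homot H m (r r' : T -> T -> Prop) phi psi :
  (forall a x y, (a < m)%N -> r x y ->
     [/\ r' (H a x) (H a y), r' (H a x) (H a.+1 y), r' (H a.+1 x) (H a y)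
       & r' (H a.+1 x) (H a.+1 y)]) ->
  (forall t, pairwise_in r' t -> phi t = psi t) ->
  forall s, pairwise_in r s -> homot H m phi s = homot H m psi s.
Proof.
move=> Hr eqf s rs; elim: m Hr => [//|m IH] Hr /=; rewrite /addc.
rewrite IH; last by move=> a x y am; apply: Hr; exact: ltnW.
congr addb; apply: eq_in_prism => t st; apply: eqf => x y /st + /st.
rewrite !mem_cat.
by move=> /orP[]/mapP[x' xs ->] /orP[]/mapP[y' ys ->];
  have [] := Hr _ _ _ (ltnSn m) (rs _ _ xs ys).
Qed.

(** The nearness relation depends on the dimension, since each contraction may enlarge the simplices
    a little. *)
Lemma eq_in_cell M om H J (r0 : T -> T -> Prop) (r : nat -> T -> T -> Prop)
    phi psi :
  (forall x y, r0 x y -> r 0%N (H 0%N M x) (H 0%N M y)) ->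
  (forall j x y, r j x y -> r j (om x) (om y)) ->
  (forall j a x y, (j < J)%N -> (a < M)%N -> r j x y ->
     [/\ r j.+1 (H j.+1 a x) (H j.+1 a y), r j.+1 (H j.+1 a x) (H j.+1 a.+1 y),
         r j.+1 (H j.+1 a.+1 x) (H j.+1 a y)
       & r j.+1 (H j.+1 a.+1 x) (H j.+1 a.+1 y)]) ->
  (forall t, pairwise_in (r J) t -> phi t = psi t) ->
  forall s, pairwise_in r0 s -> cell M om H J phi s = cell M om H J psi s.
Proof.
move=> Hr0 Hom; elim: J phi psi => [|J IH] phi psi Hr eqf s rs.
  apply: eqf => x y /mapP[x' xs ->] /mapP[y' ys ->].
  by apply: Hr0; exact: rs.
apply: IH rs => [j a x y jJ|t rt]; first by apply: Hr; exact: ltnW.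
rewrite /suspend /addc /pull; congr addb.
  by apply: (eq_in_homot _ eqf) rt => a x y; exact: Hr.
apply: (eq_in_homot _ eqf) => [a x y|]; first exact: Hr.
move=> x y /mapP[x' xs ->] /mapP[y' ys ->]; apply: Hom; exact: rt.
Qed.

End Support.

(** * Cup products of sign changes *)

Section SignChanges.
Variables (T : Type) (S : nat -> T -> bool).

(* Cup product of the coboundaries of the 0-cochains S k, ..., S 1. *)
Fixpoint changes k (s : seq T) : bool :=
  match k, s with
  | 0%N, [:: _] => true
  | k'.+1, x :: (y :: _) as s' => (S k'.+1 x (+) S k'.+1 y) && changes k' s'
  | _, _ => false
  end.

(** The cup product of [S k.+1] with [changes k]: a primitive of [changes k.+1], to which Stokes'
    formula is applied. *)
Definition signed_changes k (s : seq T) : bool :=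
  if s is x :: _ then S k.+1 x && changes k s else false.

Lemma coboundary_mask (b : bool) (phi : seq T -> bool) s :
  coboundary (fun t => b && phi t) s = b && coboundary phi s.
Proof.
elim: s phi => [|x s IH] phi /=; first by rewrite andbF.
by rewrite (IH (fun t => phi (x :: t))) -andb_addr.
Qed.

Lemma changes_nil k : changes k [::] = false.
Proof. by case: k. Qed.

Lemma coboundary_changes k : coboundary (changes k) = @zeroc T.
Proof.
apply: funext; elim: k => [|k IH] [|x [|y s]] //.
  by case: s => [|z s] //; have /(congr1 (@^~ (z :: s))) := coboundary0 T.
case: s => [//|z s].
(* By closedness of [changes k], the faces through [y] sum to the face opposite [y]. *)
have Ey : coboundary (fun t => changes k (y :: t)) (z :: s) = changes k (z :: s).
  by have /= := IH (y :: z :: s); case: (changes _ _) => //= /negbFE.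
have -> : coboundary (changes k.+1) [:: x, y, z & s] =
   ((S k.+1 y (+) S k.+1 z) && changes k (z :: s)) (+)
   (((S k.+1 x (+) S k.+1 z) && changes k (z :: s)) (+)
   coboundary (fun t => (S k.+1 x (+) S k.+1 y) && changes k (y :: t)) (z :: s))
  by [].
rewrite coboundary_mask Ey.
by case: (S k.+1 x); case: (S k.+1 y); case: (S k.+1 z); case: changes.
Qed.

Lemma coboundary_signed_changes k :
  coboundary (signed_changes k) = changes k.+1.
Proof.
apply: funext => -[//|x [|y s]] //.
have Ex : coboundary (fun t => changes k (x :: t)) (y :: s) = changes k (y :: s).
  have /(congr1 (@^~ [:: x, y & s])) /= := coboundary_changes k.
  by rewrite /zeroc; case: (changes _ _) => //= /negbFE.
have -> : coboundary (signed_changes k) [:: x, y & s] =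
   (S k.+1 y && changes k (y :: s)) (+)
   coboundary (fun t => S k.+1 x && changes k (x :: t)) (y :: s) by [].
by rewrite coboundary_mask Ex /=; case: (S k.+1 x); case: (S k.+1 y); case: changes.
Qed.

End SignChanges.

Lemma changes_sign_change (T : eqType) (S : nat -> T -> bool) K t : changes S K t ->
  forall k, (k < K)%N ->
  exists x y, [/\ x \in t, y \in t & S k.+1 x != S k.+1 y].
Proof.
elim: K t => [|K IH] [|x [|y t]] //= /andP[Sxy ct] k.
rewrite ltnS leq_eqVlt => /predU1P[->|kK].
  exists x, y; rewrite !inE !eqxx orbT; split=> //.
  by move: Sxy; case: (S _ x); case: (S _ y).
have [x' [y' [x't y't S']]] := IH _ ct k kK.
by exists x', y'; split=> //; rewrite inE ?x't ?y't orbT.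
Qed.

(** Below column [d] the table vanishes except for row 0, which is constantly true; hence column [d]
    is true as well, and from there on the recursion is Pascal's. *)
Lemma parity_binomial (P : nat -> nat -> bool) (d I J : nat) : (0 < d)%N ->
  P 0%N 0%N = true ->
  (forall j, (j < J)%N -> P 0%N j.+1 = P 0%N j) ->
  (forall i, (i < I)%N -> P i.+1 0%N = ~~ (0 < d)%N && P i 0%N) ->
  (forall i j, (i < I)%N -> (j < J)%N ->
     P i.+1 j.+1 = (~~ (j.+1 < d)%N && P i j.+1) (+) P i.+1 j) ->
  forall i l, (i <= I)%N -> (d + l <= J)%N -> P i (d + l)%N = odd 'C(i + l, i).
Proof.
case: d => // d _ P00 P0S PS0 PSS.
have P0 j : (j <= J)%N -> P 0%N j = true.
  by elim: j => // j IH jJ; rewrite P0S // IH // ltnW.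
have Plow i j : (i < I)%N -> (j <= d)%N -> (j <= J)%N -> P i.+1 j = false.
  move=> iI; elim: j => [|j IH] jd jJ; first by rewrite PS0.
  by rewrite PSS // ltnS jd IH // ltnW.
move=> i l; elim: l i => [|l IHl] i; last first.
  rewrite addnS; elim: i => [|i IHi] iI lJ; first by rewrite P0 // bin0.
  rewrite PSS // IHi //; last exact: ltnW.
  rewrite IHl //; last exact: ltnW.
  have -> : ((d.+1 + l).+1 < d.+1)%N = false by lia.
  by rewrite [(i.+1 + l.+1)%N]addSn binS oddD addbC addSnnS.
rewrite !addn0 binn; elim: i => [|i IHi] iI dJ; first exact: P0.
by rewrite PSS // IHi // ?ltnn ?Plow // ltnW.
Qed.

(** * Stokes' formula on products of cells of two spheres *)

(* On either factor, a is the antipode, h j contracts to the j-th pole and r j is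
   the nearness of two points of the j-sphere; the reflection rhoW exchanges the
   j-th poles exactly when b j. *)
Section ProductCells.
Variables (V W : eqType) (M : nat).
Variables (aV : V -> V) (hV : nat -> nat -> V -> V).
Variables (aW : W -> W) (hW : nat -> nat -> W -> W).
Variables (rhoW : W -> W) (b : nat -> bool) (I J : nat).
Variables (rV : nat -> V -> V -> Prop) (rW : nat -> W -> W -> Prop).
Variables (S : nat -> V * W -> bool) (pt : V * W).

Hypothesis aV_invol : involutive aV.
Hypothesis hV_start : forall j, hV j 0%N =1 id.
Hypothesis hV_end : forall j v, hV j M (aV v) = hV j M v.
Hypothesis aW_invol : involutive aW.
Hypothesis hW_start : forall j, hW j 0%N =1 id.
Hypothesis hW_end : forall j w, hW j M (aW w) = hW j M w.
Hypothesis rho_invol : involutive rhoW.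
Hypothesis rho_aW : forall w, rhoW (aW w) = aW (rhoW w).
Hypothesis rho_pole : forall w,
  rhoW (hW 0%N M w) = if b 0%N then aW (hW 0%N M w) else hW 0%N M w.
Hypothesis rho_hW : forall i a w,
  rhoW (hW i a w) = if b i then aW (hW i a (aW (rhoW w))) else hW i a (rhoW w).

Hypothesis rV0 : forall v v', rV 0%N (hV 0%N M v) (hV 0%N M v').
Hypothesis rV_aV : forall j v v', rV j v v' -> rV j (aV v) (aV v').
Hypothesis rV_hV : forall j a v v', (j < I)%N -> (a < M)%N -> rV j v v' ->
  [/\ rV j.+1 (hV j.+1 a v) (hV j.+1 a v'),
      rV j.+1 (hV j.+1 a v) (hV j.+1 a.+1 v'),
      rV j.+1 (hV j.+1 a.+1 v) (hV j.+1 a v')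
    & rV j.+1 (hV j.+1 a.+1 v) (hV j.+1 a.+1 v')].
Hypothesis rW0 : forall w w', rW 0%N (hW 0%N M w) (hW 0%N M w').
Hypothesis rW_aW : forall j w w', rW j w w' -> rW j (aW w) (aW w').
Hypothesis rW_hW : forall j a w w', (j < J)%N -> (a < M)%N -> rW j w w' ->
  [/\ rW j.+1 (hW j.+1 a w) (hW j.+1 a w'),
      rW j.+1 (hW j.+1 a w) (hW j.+1 a.+1 w'),
      rW j.+1 (hW j.+1 a.+1 w) (hW j.+1 a w')
    & rW j.+1 (hW j.+1 a.+1 w) (hW j.+1 a.+1 w')].

Hypothesis S_aW : forall k i j v w, rV i v v -> rW j w w ->
  S k (v, aW w) = ~~ S k (v, w).
Hypothesis S_aV : forall k i j v w, rV i v v -> rW j w w ->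
  S k (aV v, rhoW w) = ~~ S k (v, w).

Let omV (x : V * W) := (aV x.1, x.2).
Let omW (x : V * W) := (x.1, aW x.2).
Let rho (x : V * W) := (x.1, rhoW x.2).
Let HV j a (x : V * W) := (hV j a x.1, x.2).
Let HW j a (x : V * W) := (x.1, hW j a x.2).

Definition product_cell i j phi := cell M omV HV i (cell M omW HW j phi) [:: pt].

Definition rr i j (x y : V * W) := rV i x.1 y.1 /\ rW j x.2 y.2.

Lemma eq_in_product_cell i j phi psi : (i <= I)%N -> (j <= J)%N ->
  (forall t, pairwise_in (rr i j) t -> phi t = psi t) ->
  product_cell i j phi = product_cell i j psi.
Proof.
move=> iI jJ eqf; rewrite /product_cell.
apply: (@eq_in_cell _ M omV HV i (fun _ _ => True)
         (fun i' x y => rV i' x.1 y.1)) => //=.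
- by move=> j' x y; exact: rV_aV.
- by move=> j' a x y j'i; apply: rV_hV; exact: leq_trans iI.
- move=> s; apply: (@eq_in_cell _ M omW HW j (fun x y => rV i x.1 y.1) (rr i)) => //=.
  + by move=> x y rxy; split => //; exact: rW0.
  + by move=> j' x y [? ?]; split=> //=; exact: rW_aW.
  + move=> j' a x y j'j aM [? /(rW_hW (leq_trans j'j jJ) aM)[]].
    by split; split.
Qed.

Let omV_invol : omV \o omV = id.
Proof. by apply: funext => -[v w]; rewrite /omV /= aV_invol. Qed.

Let omW_invol : omW \o omW = id.
Proof. by apply: funext => -[v w]; rewrite /omW /= aW_invol. Qed.

Let HV_start j : HV j 0%N = id.
Proof. by apply: funext => -[v w]; rewrite /HV /= hV_start. Qed.

Let HW_start j : HW j 0%N = id.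
Proof. by apply: funext => -[v w]; rewrite /HW /= hW_start. Qed.

Let HV_end j : HV j M \o omV = HV j M.
Proof. by apply: funext => -[v w]; rewrite /HV /= hV_end. Qed.

Let HW_end j : HW j M \o omW = HW j M.
Proof. by apply: funext => -[v w]; rewrite /HW /= hW_end. Qed.

Lemma changes_anti (g : V * W -> V * W) (c : bool) k t :
  (forall k x, x \in t -> S k (g x) = c (+) S k x) ->
  changes S k (map g t) = changes S k t.
Proof.
elim: k t => [|k IH] [|x [|y t]] //= gS.
rewrite -[g y :: map g t]/(map g (y :: t)) IH; last first.
  by move=> k' z zt; apply: gS; rewrite inE zt orbT.
rewrite !gS ?inE ?eqxx ?orbT //.
by case: c {gS IH}; case: (S k.+1 x); case: (S k.+1 y).
Qed.

(** Flipping all signs leaves [changes] fixed, so only the leading factor of [signed_changes]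
    varies. *)
Lemma addc_signed_changes (g : V * W -> V * W) (c : bool) k t :
  (forall k x, x \in t -> S k (g x) = c (+) S k x) ->
  addc (signed_changes S k) (pull g (signed_changes S k)) t = c && changes S k t.
Proof.
case: t => [|x t] gS; first by rewrite /addc /= changes_nil andbF.
have -> : addc (signed_changes S k) (pull g (signed_changes S k)) (x :: t) =
  (S k.+1 x && changes S k (x :: t)) (+)
  (S k.+1 (g x) && changes S k (map g (x :: t))) by [].
rewrite (changes_anti _ gS) gS ?inE ?eqxx //.
by case: c {gS}; case: (S _ x); case: (changes _ _ _).
Qed.

Lemma signed_changes_omW i j k t : pairwise_in (rr i j) t ->
  addc (signed_changes S k) (pull omW (signed_changes S k)) t = changes S k t.
Proof.
move=> rt; rewrite (addc_signed_changes (c := true)) // => k' [v w] xt.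
by have [rv rw] := rt _ _ xt xt; rewrite /omW /= (S_aW _ rv rw).
Qed.

(** This is where the twist enters: the antipode of the V-cell contributes only if [rhoW] preserves
    the [j]-cell of the other sphere. *)
Lemma cell_omV j k i : (i <= I)%N -> (j <= J)%N ->
  cell M omV HV i (addc (cell M omW HW j (signed_changes S k))
         (pull omV (cell M omW HW j (signed_changes S k)))) [:: pt] =
  ~~ b j && product_cell i j (changes S k).
Proof.
move=> iI jJ; set phi := signed_changes S k.
rewrite (cell_pull_comm M (om := omW)) //.
(* Factor [omV] into the symmetry [omV \o rho], which flips all signs, and the reflection [rho],
   which [cell_reflect] absorbs. *)
have -> : pull omV phi = pull rho (pull (omV \o rho) phi).
  have omV_rho : (omV \o rho) \o rho = omV.
    by apply: funext => -[v w]; rewrite /omV /rho /= rho_invol.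
  by rewrite pull_comp omV_rho.
rewrite (cell_reflect omW_invol (b := b)); first last.
- by move=> i' a; case E: (b i'); apply: funext => -[v w];
    rewrite /rho /omW /HW /= rho_hW E.
- by case E: (b 0%N); apply: funext => -[v w];
    rewrite /rho /omW /HW /= rho_pole E.
- by apply: funext => -[v w]; rewrite /rho /omW /= rho_aW.
rewrite -cellD -/(product_cell i j _).
(* If [b j], the absorbed reflection adds an antipode [omW]; the two sign flips cancel and so do the
   two terms. *)
case: (b j) => /=.
  transitivity (product_cell i j (@zeroc _)); last by rewrite /product_cell !cell0.
  apply: eq_in_product_cell => // t rt; rewrite pull_comp.
  rewrite (addc_signed_changes (c := false)) // => k' [v w] xt.
  have [rv rw] := rt _ _ xt xt; rewrite /omW /omV /rho /=.
  by rewrite (S_aV _ rv (rW_aW rw)) (S_aW _ rv rw) negbK.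
apply: eq_in_product_cell => // t rt.
rewrite (addc_signed_changes (c := true)) // => k' [v w] xt.
by have [rv rw] := rt _ _ xt xt; rewrite /omV /rho /= (S_aV _ rv rw).
Qed.

Definition parity i j := product_cell i j (changes S (i + j)).

Lemma parity0S j : (j < J)%N -> parity 0 j.+1 = parity 0 j.
Proof.
move=> jJ; rewrite {1}/parity /product_cell add0n -coboundary_signed_changes.
rewrite (cellS_coboundary omW_invol HW_start HW_end) cellD cell0_coboundary.
rewrite addcE coboundary_seq1.
rewrite cell_pole pull_nil cell_nil addFb -/(product_cell 0 j _).
apply: eq_in_product_cell => [||t]; [by []|exact: ltnW|].
exact: signed_changes_omW.
Qed.

Lemma parityS0 i : (i < I)%N -> parity i.+1 0 = ~~ b 0%N && parity i 0.
Proof.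
move=> iI; rewrite {1}/parity /product_cell addSn -coboundary_signed_changes.
rewrite cell0_coboundary (cellS_coboundary omV_invol HV_start HV_end).
by rewrite addcE (cell_omV _ (ltnW iI) (leq0n J)) coboundary_seq1 cell_nil addFb.
Qed.

(** Stokes on both factors: the boundary of the V-cell gives the first term by [cell_omV], that of
    the W-cell the second by oddness. *)
Lemma paritySS i j : (i < I)%N -> (j < J)%N ->
  parity i.+1 j.+1 = (~~ b j.+1 && parity i j.+1) (+) parity i.+1 j.
Proof.
move=> iI jJ; rewrite {1}/parity /product_cell addnS -coboundary_signed_changes.
rewrite (cellS_coboundary omW_invol HW_start HW_end) cellD.
rewrite (cellS_coboundary omV_invol HV_start HV_end).
rewrite addcE; congr addb.
  rewrite addcE (cell_omV _ (ltnW iI) jJ) coboundary_seq1 cell_nil addFb.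
  by rewrite /parity addSnnS.
apply: eq_in_product_cell => [||t]; [by []|exact: ltnW|].
exact: signed_changes_omW.
Qed.

(** If [changes] vanished on all small tuples, locality would give [parity I J = false], against the
    odd binomial coefficient. *)
Lemma exists_changes d l : (0 < d)%N -> J = (d + l)%N ->
  (forall j, b j = (j < d)%N) -> odd 'C(I + l, I) ->
  exists2 t, pairwise_in (rr I J) t & changes S (I + J) t.
Proof.
move=> d0 Jdl bd oddC; apply: contrapT => /forall2NP nt.
have : parity I J = true.
  rewrite Jdl (@parity_binomial parity d I J) -?Jdl //.
  - exact: parity0S.
  - by move=> i iI; rewrite parityS0 // bd.
  - by move=> i j iI jJ; rewrite paritySS // bd.
have -> // : parity I J = false.
transitivity (product_cell I J (@zeroc _)); last by rewrite /product_cell !cell0.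
apply: eq_in_product_cell => // t rt.
by have [//|/negP/negbTE] := nt t.
Qed.

End ProductCells.

Local Open Scope classical_set_scope.
Local Open Scope ring_scope.

(** * The cross-polytope sphere and its contractions to the poles *)

Section Crosspolytope.
Variables (R : realType) (q m : nat).
Implicit Types (v w : 'rV[R]_q).

Definition l1_norm v : R := \sum_l `|v 0 l|.

(** On this sphere a straight segment from a lower-dimensional subsphere to a new pole needs no
    renormalization. *)
Definition l1_sphere : set 'rV[R]_q := [set v | l1_norm v = 1].

Definition pole j : 'rV[R]_q := \row_l ((l : nat) == j)%:R.

Definition toward j (s : R) v := (1 - s) *: v + s *: pole j.

Definition to_pole j a v := toward j (a%:R / m.+1%:R) v.

Definition close_in_sphere j v w :=
  [/\ l1_sphere v, l1_sphere w,
      forall l : 'I_q, (j < l)%N -> v 0 l = 0 /\ w 0 l = 0 &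
      forall l, `|v 0 l - w 0 l| <= j%:R * (2 / m.+1%:R)].

Lemma l1_sphere_le1 v l : l1_sphere v -> `|v 0 l| <= 1.
Proof.
move=> v1; rewrite -(v1 : l1_norm v = 1) /l1_norm (bigD1 l) //= lerDl.
by apply: sumr_ge0 => i _.
Qed.

Lemma l1_sphereN v : l1_sphere v -> l1_sphere (- v).
Proof.
move=> v1; rewrite /l1_sphere /= -(v1 : l1_norm v = 1).
by apply: eq_bigr => l _; rewrite mxE normrN.
Qed.

Lemma sum_pole j : (j < q)%N -> \sum_l pole j 0 l = 1.
Proof.
move=> jq; rewrite (bigD1 (Ordinal jq)) //= mxE eqxx big1 ?addr0 // => l.
by rewrite mxE -val_eqE /= => /negbTE ->.
Qed.

Lemma l1_sphere_pole j : (j < q)%N -> l1_sphere (pole j).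
Proof.
move=> /sum_pole jq; rewrite /l1_sphere /= -jq; apply: eq_bigr => l _.
by rewrite ger0_norm // mxE ler0n.
Qed.

Lemma to_pole_start j : to_pole j 0 =1 id.
Proof. by move=> v; rewrite /to_pole /toward mul0r subr0 scale1r scale0r addr0. Qed.

Lemma to_pole_end j v : to_pole j m.+1 v = pole j.
Proof.
by rewrite /to_pole /toward divff ?pnatr_eq0 // subrr scale0r add0r scale1r.
Qed.

Lemma ratio_ge0 a : 0 <= a%:R / m.+1%:R :> R.
Proof. by rewrite divr_ge0 ?ler0n. Qed.

Lemma ratio_le1 a : (a <= m.+1)%N -> a%:R / m.+1%:R <= 1 :> R.
Proof. by move=> am; rewrite ler_pdivrMr ?ltr0n // mul1r ler_nat. Qed.

Lemma toward_coord j s v l :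
  toward j s v 0 l = (1 - s) * v 0 l + s * pole j 0 l.
Proof. by rewrite !mxE. Qed.

(** [v] and the pole have disjoint supports, so their norms add. *)
Lemma l1_sphere_toward j s v : (j < q)%N -> 0 <= s <= 1 ->
  l1_sphere v -> (forall l : 'I_q, (j <= l)%N -> v 0 l = 0) ->
  l1_sphere (toward j s v).
Proof.
move=> jq /andP[s0 s1] v1 v0; rewrite /l1_sphere /=.
transitivity (\sum_l ((1 - s) * `|v 0 l| + s * pole j 0 l)).
  apply: eq_bigr => l _; rewrite toward_coord mxE.
  have [lj|lj] := eqVneq (l : nat) j.
    by rewrite v0 ?lj // normr0 !mulr0 !add0r mulr1 ger0_norm.
  by rewrite !mulr0 !addr0 normrM ger0_norm // subr_ge0.
by rewrite big_split -!mulr_sumr sum_pole //= -/(l1_norm v) v1 !mulr1 subrK.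
Qed.

Lemma toward_close j s s' v w e l : 0 <= s <= 1 ->
  `|v 0 l - w 0 l| <= e -> `|w 0 l| <= 1 ->
  `|toward j s v 0 l - toward j s' w 0 l| <= e + `|s' - s| * 2.
Proof.
move=> /andP[s0 s1] vw w1; rewrite !toward_coord.
have -> : (1 - s) * v 0 l + s * pole j 0 l - ((1 - s') * w 0 l + s' * pole j 0 l)
  = (1 - s) * (v 0 l - w 0 l) + (s' - s) * (w 0 l - pole j 0 l) by ring.
apply: le_trans (ler_normD _ _) _; rewrite !normrM; apply: lerD.
  rewrite ger0_norm ?subr_ge0 //; apply: le_trans vw.
  by rewrite ler_piMl // gerBl.
apply: ler_wpM2l => //; apply: le_trans (ler_normB _ _) _.
rewrite mxE; have : `|((l : nat) == j)%:R| <= 1 :> R.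
  by rewrite ger0_norm ?ler0n // lern1 leq_b1.
by lra.
Qed.

Lemma close_in_sphere_pole v w : (0 < q)%N ->
  close_in_sphere 0 (to_pole 0 m.+1 v) (to_pole 0 m.+1 w).
Proof.
move=> q0; rewrite !to_pole_end; split; try exact: l1_sphere_pole.
  by move=> l; rewrite !mxE lt0n => /negbTE ->.
by move=> l; rewrite subrr normr0 mul0r.
Qed.

Lemma close_in_sphereN j v w :
  close_in_sphere j v w -> close_in_sphere j (- v) (- w).
Proof.
move=> [v1 w1 vw0 vw]; split; try exact: l1_sphereN.
  by move=> l /vw0[]; rewrite !mxE => -> ->; rewrite oppr0.
by move=> l; rewrite !mxE -opprD normrN.
Qed.

(** Step numbers differing by at most one cover all pairs of vertices of a single prism. *)
Lemma close_in_sphere_to_pole j a a' v w : (j.+1 < q)%N ->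
  (a <= m.+1)%N -> (a' <= m.+1)%N -> (a <= a'.+1)%N -> (a' <= a.+1)%N ->
  close_in_sphere j v w ->
  close_in_sphere j.+1 (to_pole j.+1 a v) (to_pole j.+1 a' w).
Proof.
move=> jq am a'm aa' a'a [v1 w1 vw0 vw].
have s01 b : (b <= m.+1)%N -> 0 <= (b%:R / m.+1%:R : R) <= 1.
  by move=> bm; rewrite ratio_ge0 ratio_le1.
split.
- apply: l1_sphere_toward => //; first exact: s01.
  by move=> l jl; have [] := vw0 l.
- apply: l1_sphere_toward => //; first exact: s01.
  by move=> l jl; have [] := vw0 l.
- move=> l jl; have [v0 w0] := vw0 l (ltnW jl).
  rewrite !toward_coord v0 w0 mxE gtn_eqF //.
  by rewrite !mulr0 addr0.
- move=> l; apply: le_trans (toward_close _ _ (s01 a am) (vw l) _) _.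
    exact: l1_sphere_le1.
  rewrite -mulrBl normrM [`|_^-1|]ger0_norm ?invr_ge0 ?ler0n //.
  have : `|a'%:R - a%:R| <= 1 :> R.
    by rewrite ler_distl lerBlDr !natr1 !ler_nat aa' a'a.
  have i0 : 0 <= m.+1%:R^-1 :> R by rewrite invr_ge0 ler0n.
  move=> /(ler_wpM2r i0); rewrite -[j.+1%:R]natr1 mul1r => h.
  rewrite [leRHS]mulrDl lerD2l mul1r [leRHS]mulrC; exact: ler_wpM2r.
Qed.

End Crosspolytope.

(** * Odd sign functions on nonzero vectors *)

Section CoordinateSign.
Variables (R : realType) (n : nat).
Implicit Types u : 'rV[R]_n.

(* The sign of the k-th coordinate (counting from 1); where that coordinate
   vanishes, the sign of some other nonzero coordinate, so that the sign is odd
   in u != 0. *)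
Definition coord_sign u k : bool :=
  if [pick i : 'I_n | (i.+1 == k) && (u 0 i != 0)] is Some i then 0 < u 0 i
  else if [pick i | u 0 i != 0] is Some i then 0 < u 0 i else true.

Lemma coord_signN u k : u != 0 -> coord_sign (- u) k = ~~ coord_sign u k.
Proof.
move=> u0; rewrite /coord_sign.
have Nu i : ((- u) 0 i != 0) = (u 0 i != 0) by rewrite mxE oppr_eq0.
have Np i : u 0 i != 0 -> (0 < (- u) 0 i) = ~~ (0 < u 0 i).
  by move=> ui; rewrite mxE oppr_gt0 -leNgt lt_neqAle ui.
under eq_pick do rewrite Nu.
case: pickP => [i /andP[_ /Np //]|_].
under eq_pick do rewrite Nu.
case: pickP => [i /Np //|u_eq0].
case/eqP: u0; apply/rowP => i; rewrite mxE.
by apply/eqP; have /negbFE := u_eq0 i.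
Qed.

Lemma coord_sign_eq u u' (i : 'I_n) : 0 < u 0 i * u' 0 i ->
  coord_sign u i.+1 = coord_sign u' i.+1.
Proof.
move=> uu'; have [u0 u'0] : u 0 i != 0 /\ u' 0 i != 0.
  by split; apply: contraTneq uu' => ->; rewrite ?mul0r ?mulr0 ltxx.
rewrite /coord_sign; case: pickP => [j /andP[/eqP[/val_inj ->] _]|/(_ i)]; last first.
  by rewrite eqxx u0.
case: pickP => [k /andP[/eqP[/val_inj ->] _]|/(_ i)]; last first.
  by rewrite eqxx u'0.
have [un|up|/eqP] := ltgtP (u 0 i) 0; last by rewrite (negbTE u0).
  by move: uu'; rewrite nmulr_rgt0 // => /lt_gtF.
by move: uu'; rewrite pmulr_rgt0.
Qed.

End CoordinateSign.

(** * Compactness of the sphere *)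

Lemma l1_norm_continuous (R : realType) q : continuous (@l1_norm R q).
Proof.
rewrite /l1_norm; apply: continuous_big => [|l _ v]; first exact: add_continuous.
apply: (continuous_comp (f := fun x : 'rV[R]_q => x 0 l)).
  exact: coord_continuous.
exact: norm_continuous.
Qed.

Lemma compact_l1_sphere (R : realType) q : compact (@l1_sphere R q).
Proof.
have box : compact [set v : 'rV[R]_q | forall l, `[(-1 : R), 1]%classic (v 0 l)].
  apply: (@rV_compact R q (fun=> `[(-1 : R), 1]%classic)) => _.
  exact: segment_compact.
apply: subclosed_compact box _; last first.
  by move=> v v1 l /=; rewrite in_itv /= -ler_norml l1_sphere_le1.
apply: (@preimage_closed _ _ (@l1_norm R q) [set r | r = 1]) => [v _|].
  exact: l1_norm_continuous.
exact: closed_eq.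
Qed.

(** * A Borsuk-Ulam theorem for a twisted product of two spheres *)

Section BorsukUlam.
Variables (R : realType) (I d n : nat).
Local Notation V := 'rV[R]_I.+1.
Local Notation W := 'rV[R]_(d + d).+1.

Definition flip_low (w : W) : W := \row_l (if (l < d)%N then - w 0 l else w 0 l).

Variable F : V * W -> 'rV[R]_n.
Hypothesis d0 : (0 < d)%N.
Hypothesis n_le : (n <= I + (d + d))%N.
Hypothesis odd_bin : odd 'C(I + d, I).
Hypothesis F_cont : forall k, continuous (fun x => F x 0 k).
Hypothesis F_aW : forall v w, F (v, - w) = - F (v, w).
Hypothesis F_aV : forall v w, F (- v, flip_low w) = - F (v, w).

Lemma flip_lowK : involutive flip_low.
Proof.
by move=> w; apply/rowP => l; rewrite !mxE; case: (l < d)%N; rewrite ?opprK.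
Qed.

Lemma flip_low_pole j : flip_low (pole R _ j) =
  if (j < d)%N then - pole R _ j else pole R _ j.
Proof.
apply/rowP => l.
have -> : (if (j < d)%N then - pole R _ j else pole R _ j : W) 0 l =
    if (j < d)%N then - (l == j :> nat)%:R else (l == j :> nat)%:R.
  by case: ifP => _; rewrite !mxE.
rewrite !mxE; have [->//|lj] := eqVneq (l : nat) j.
by rewrite oppr0 !if_same.
Qed.

Lemma flip_lowN w : flip_low (- w) = - flip_low w.
Proof. by apply/rowP => l; rewrite !mxE; case: ifP. Qed.

Lemma flip_low_comb a b v w :
  flip_low (a *: v + b *: w) = a *: flip_low v + b *: flip_low w.
Proof.
by apply/rowP => l; rewrite !mxE; case: ifP => // _; rewrite opprD !mulrN.
Qed.

Lemma flip_low_to_pole m j a w : flip_low (to_pole m j a w) =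
  if (j < d)%N then - to_pole m j a (- flip_low w) else to_pole m j a (flip_low w).
Proof.
rewrite flip_low_comb flip_low_pole; case: ifP => // _.
by rewrite /to_pole /toward !scalerN opprD opprK.
Qed.

Lemma mesh_sign_changes m :
  (forall v w, l1_sphere v -> l1_sphere w -> F (v, w) != 0) ->
  exists2 t : seq (V * W), pairwise_in (fun x y =>
    close_in_sphere m I x.1 y.1 /\ close_in_sphere m (d + d) x.2 y.2) t &
    changes (fun k x => coord_sign (F x) k) (I + (d + d)) t.
Proof.
move=> F0.
have sphere_step q j a v v' : (j.+1 < q)%N -> (a < m.+1)%N ->
    close_in_sphere m j v v' ->
  [/\ close_in_sphere (q := q) m j.+1 (to_pole m j.+1 a v) (to_pole m j.+1 a v'),
      close_in_sphere (q := q) m j.+1 (to_pole m j.+1 a v) (to_pole m j.+1 a.+1 v'),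
      close_in_sphere (q := q) m j.+1 (to_pole m j.+1 a.+1 v) (to_pole m j.+1 a v')
    & close_in_sphere (q := q) m j.+1 (to_pole m j.+1 a.+1 v) (to_pole m j.+1 a.+1 v')].
  by move=> jq am vv'; split; apply: close_in_sphere_to_pole => //; exact: ltnW.
have stop q j (v : 'rV[R]_q) : to_pole m j m.+1 (- v) = to_pole m j m.+1 v.
  by rewrite !to_pole_end.
have S_W k i j v w : close_in_sphere m i v v -> close_in_sphere m j w w ->
    coord_sign (F (v, - w)) k = ~~ coord_sign (F (v, w)) k.
  by move=> [v1 _ _ _] [w1 _ _ _]; rewrite F_aW coord_signN // F0.
have S_V k i j v w : close_in_sphere m i v v -> close_in_sphere m j w w ->
    coord_sign (F (- v, flip_low w)) k = ~~ coord_sign (F (v, w)) k.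
  by move=> [v1 _ _ _] [w1 _ _ _]; rewrite F_aV coord_signN // F0.
have pole_V v v' : close_in_sphere m 0 (to_pole m 0 m.+1 v) (to_pole m 0 m.+1 v' : V).
  exact: close_in_sphere_pole.
have pole_W w w' : close_in_sphere m 0 (to_pole m 0 m.+1 w) (to_pole m 0 m.+1 w' : W).
  exact: close_in_sphere_pole.
have flip_start w : flip_low (to_pole m 0 m.+1 w) =
    if (0 < d)%N then - to_pole m 0 m.+1 w else to_pole m 0 m.+1 w.
  by rewrite to_pole_end flip_low_pole.
(* The second sphere has dimension [d + d], so [l = d]. The base point 0 is off the spheres, but the
   0-cells send it to the poles. *)
have [] // := @exists_changes V W m.+1 -%R (to_pole m) -%R (to_pole m) flip_low
  (fun j => (j < d)%N) I (d + d)%N (close_in_sphere m) (close_in_sphere m)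
  (fun k x => coord_sign (F x) k) 0
  (@opprK V) (@to_pole_start R _ m) (stop _)
  (@opprK W) (@to_pole_start R _ m) (stop _)
  flip_lowK flip_lowN flip_start (flip_low_to_pole m) pole_V
  (@close_in_sphereN _ _ _) _ pole_W (@close_in_sphereN _ _ _) _ S_W S_V d d.
- by move=> j a v v' jI; apply: sphere_step.
- by move=> j a w w' jI; apply: sphere_step.
by move=> t rt ct; exists t.
Qed.

Theorem borsuk_ulam : exists v w, [/\ l1_sphere v, l1_sphere w & F (v, w) = 0].
Proof.
apply: contrapT => no_zero.
have F0 v w : l1_sphere v -> l1_sphere w -> F (v, w) != 0.
  by move=> v1 w1; apply/eqP => Fvw; apply: no_zero; exists v, w.
(* [close_in_sphere] bounds distances by dimension times [2 / m.+1]; the extra 1 makes the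
   inequality strict for open balls. *)
pose C : R := (I + (d + d))%:R * 2 + 1.
have C0 : 0 < C by rewrite ltr_wpDl // mulr_ge0 // ler0n.
(* At scale [m], some coordinate of [F] keeps its sign near [x]. Compactness yields one [m] for all
   points of the product of spheres. *)
pose P m (x : V * W) := exists i, forall y z,
  ball x (C / m.+1%:R) y -> ball x (C / m.+1%:R) z ->
  0 < F y 0 i * F z 0 i.
have := compact_setX (@compact_l1_sphere R I.+1) (@compact_l1_sphere R (d + d).+1).
move=> /compact_near_coveringP /(_ nat \oo P _)[].
  move=> [v w] [/= v1 w1].
  have /eqP/rowP/existsNP[i /eqP] := F0 v w v1 w1; rewrite mxE => Fi.
  have : nbhs (v, w) [set y | 0 < F (v, w) 0 i * F y 0 i].
    have : {for (v, w), continuous (fun y => F (v, w) 0 i * F y 0 i)}.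
      by apply: continuousM; [exact: cvg_cst|exact: F_cont].
    move=> /(_ [set r | 0 < r]); apply; apply: lt_nbhsr.
    by rewrite -expr2 exprn_even_gt0.
  move=> /nbhs_ballP[e /= e0 be].
  have e2 : 0 < e / 2 by rewrite divr_gt0.
  exists (ball (v, w) (e / 2), [set m | C / m.+1%:R < e / 2]).
    split; first exact: nbhsx_ballx.
    have := @near_infty_natSinv_lt R (PosNum (divr_gt0 e2 C0)).
    apply: filterS => m /=; rewrite ltr_pdivlMr // mulrC.
    by [].
  move=> [x m] [/= vwx Cm]; exists i => y z xy xz.
  have pos u : ball x (C / m.+1%:R) u -> 0 < F (v, w) 0 i * F u 0 i.
    move=> xu; apply: be; apply: (ball_split vwx).
    by apply: le_ball xu; exact: ltW.
  have := mulr_gt0 (pos _ xy) (pos _ xz); rewrite mulrACA pmulr_rgt0 //.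
  by rewrite -expr2 exprn_even_gt0.
move=> m _ /(_ m (leqnn m)) /= Pm.
have [t rt ct] := mesh_sign_changes m F0.
have [[v w] vwt] : exists x, x \in t.
  by case: t {rt} ct => [|x t]; [rewrite changes_nil|exists x; rewrite inE eqxx].
have [/= [v1 _ _ _] [w1 _ _ _]] := rt _ _ vwt vwt.
have [i Pi] := Pm (v, w) (conj v1 w1).
(* As [n <= I + (d + d)], the coordinate [i] is among those whose sign changes on [t]. *)
have [y [z [yt zt]]] := changes_sign_change ct (leq_trans (ltn_ord i) n_le).
rewrite (@coord_sign_eq _ _ _ (F z) i) ?eqxx //.
have near_t u : u \in t -> ball (v, w) (C / m.+1%:R) u.
  have close_ball q j (a b : 'rV[R]_q) : (j <= I + (d + d))%N ->
      close_in_sphere m j a b -> ball a (C / m.+1%:R) b.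
    move=> jC [_ _ _ ab]; split=> [|k l]; first by rewrite divr_gt0.
    rewrite ord1; apply: le_lt_trans (ab l) _.
    rewrite mulrA ltr_pM2r ?invr_gt0 // /C.
    rewrite (@le_lt_trans _ _ ((I + (d + d))%:R * 2)) ?ltrDl //.
    by rewrite ler_wpM2r // ler_nat.
  move=> ut; have [] := rt _ _ vwt ut => /= vu wu.
  split; first by apply: close_ball vu; rewrite leq_addr.
  by apply: close_ball wu; rewrite leq_addl.
by apply: Pi; exact: near_t.
Qed.

End BorsukUlam.

(** * Parity of binomial coefficients and the power of 2 dividing d *)

(** Lucas' theorem for the last binary digit, from the double Pascal step [binSS], whose middle
    terms cancel mod 2. *)
Lemma odd_bin_double n k :
  odd 'C(n.*2, k.*2) = odd 'C(n, k) /\ odd 'C(n.*2, k.*2.+1) = false.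
Proof.
elim: n k => [|n IH] [|k]; rewrite ?doubleS ?bin0 ?bin1 ?bin0n //=.
  by rewrite odd_double.
have binSS a b : odd 'C(a.+2, b.+2) = odd 'C(a, b.+2) (+) odd 'C(a, b).
  by rewrite !binS !oddD; case: (odd 'C(a, b.+1)); case: odd; case: odd.
rewrite !binSS -!doubleS (IH k).1 (IH k).2 (IH k.+1).1 (IH k.+1).2.
by rewrite binS oddD.
Qed.

(** The last [g] binary digits of both entries are 1; the induction strips one digit at a time. *)
Lemma odd_bin_pow2 g m : odd 'C((2 ^ g).-1 + 2 ^ g * m, (2 ^ g).-1).
Proof.
elim: g => [|g IH]; first by rewrite bin0.
have p0 : (0 < 2 ^ g)%N by rewrite expn_gt0.
have -> : ((2 ^ g.+1).-1 = ((2 ^ g).-1).*2.+1)%N by rewrite expnS; lia.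
have -> : (((2 ^ g).-1).*2.+1 + 2 ^ g.+1 * m = ((2 ^ g).-1 + 2 ^ g * m).*2.+1)%N.
  by rewrite expnS; lia.
move: IH; rewrite binS oddD (odd_bin_double _ _).2.
by rewrite (odd_bin_double _ _).1.
Qed.

(** The inequality [2 ^ b + 8 * a <= 2 ^ (4 * a + b)] bounds the Hurwitz-Radon number by the 2-part
    of [d]. *)
Lemma pow2_gamma_dvd d : (0 < d)%N -> (2 ^ gamma d %| d)%N.
Proof.
move=> d0; apply: (@dvdn_trans (2 ^ logn 2 d)); last exact: pfactor_dvdnn.
apply: dvdn_exp2l; apply: up_log_min => //; rewrite /hurwitz_radon.
rewrite [X in (_ <= 2 ^ X)%N](divn_eq _ 4).
move: (logn 2 d %% 4)%N (logn 2 d %/ 4)%N => b a.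
have b0 : (0 < 2 ^ b)%N by rewrite expn_gt0.
have : (1 + 8 * a <= 2 ^ (a * 4))%N.
  elim: a => [//|a IH]; rewrite [(a.+1 * 4)%N]mulSn expnD.
  by move: IH; set x := (2 ^ (a * 4))%N; lia.
by rewrite expnD; nia.
Qed.

(** * Parallel chords give a trapezoid or a collinear triple *)

Section Collinearity.
Variables (R : realType) (d n : nat) (f : 'rV[R]_d -> 'rV[R]_n).
Hypothesis f_inj : injective f.

(** If the pairs share a point, the three remaining distinct points map to one line; otherwise the
    four images form a trapezoid unless three of them are collinear. *)
Lemma trapezoid_or_line x1 y1 x2 y2 (l m : R) :
  x1 != y1 -> x2 != y2 -> (x1, y1) != (x2, y2) -> (x1, y1) != (y2, x2) ->
  0 < l -> 0 < m -> l *: (f x1 - f y1) = m *: (f x2 - f y2) ->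
  inscribes_trapezoid f \/ maps_three_to_line f.
Proof.
move=> xy1 xy2 n1 n2 l0 m0 lm.
set D := f x1 - f y1; set r := l / m.
have D0 : D != 0 by rewrite subr_eq0 (inj_eq f_inj).
have rD : f x2 - f y2 = r *: D.
  by rewrite /r mulrC -scalerA lm scalerA mulVf ?gt_eqF // scale1r.
have on_line s : affine_line (f x1) D (f x1 + s *: D) by exists s.
have line3 x y z s1 s2 s3 : uniq [:: x; y; z] ->
    f x = f x1 + s1 *: D -> f y = f x1 + s2 *: D -> f z = f x1 + s3 *: D ->
    maps_three_to_line f.
  move=> u fx fy fz; exists x, y, z; split=> //; exists (f x1), D; split=> //.
  by split; [rewrite fx|rewrite fy|rewrite fz].
have fx1 : f x1 = f x1 + 0 *: D by rewrite scale0r addr0.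
have fy1 : f y1 = f x1 + (-1) *: D by rewrite scaleN1r /D opprB addrC subrK.
have fx2 : f x2 = f y2 + r *: D by rewrite -rD addrC subrK.
have fy2 : f y2 = f x2 + (- r) *: D by rewrite scaleNr -rD opprB addrC subrK.
have [e1|x12] := eqVneq x1 x2.
  right; apply: (@line3 x1 y1 y2 _ _ (- r) _ fx1 fy1); last by rewrite fy2 -e1.
  rewrite /= !inE negb_or xy1 e1 xy2 /= andbT.
  by apply: contraNneq n1 => ->; rewrite e1.
have [e2|xy12] := eqVneq x1 y2.
  right; apply: (@line3 x1 y1 x2 _ _ r _ fx1 fy1); last by rewrite fx2 -e2.
  rewrite /= !inE negb_or xy1 x12 /= andbT.
  by apply: contraNneq n2 => ->; rewrite e2.
have [e3|yx12] := eqVneq y1 x2.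
  right; apply: (@line3 x1 y1 y2 _ _ (-1 - r) _ fx1 fy1).
    by rewrite /= !inE negb_or xy1 xy12 /= andbT e3.
  by rewrite fy2 -e3 fy1 -addrA -scalerDl.
have [e4|y12] := eqVneq y1 y2.
  right; apply: (@line3 x1 y1 x2 _ _ (-1 + r) _ fx1 fy1).
    by rewrite /= !inE negb_or xy1 x12 /= andbT.
  by rewrite fx2 -e4 fy1 -addrA -scalerDl.
have [c1|c1] := pselect (collinear (f x1) (f y1) (f x2)).
  by right; exists x1, y1, x2; split=> //; rewrite /= !inE negb_or xy1 x12 yx12.
have [c2|c2] := pselect (collinear (f x1) (f y1) (f y2)).
  by right; exists x1, y1, y2; split=> //; rewrite /= !inE negb_or xy1 xy12 y12.
have [c3|c3] := pselect (collinear (f x1) (f x2) (f y2)).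
  by right; exists x1, x2, y2; split=> //; rewrite /= !inE negb_or x12 xy12 xy2.
have [c4|c4] := pselect (collinear (f y1) (f x2) (f y2)).
  by right; exists y1, x2, y2; split=> //; rewrite /= !inE negb_or yx12 y12 xy2.
left; exists (f x1), (f y1), (f x2), (f y2); split=> //; last by exists l, m.
by rewrite /= !inE !negb_or !(inj_eq f_inj) xy1 x12 xy12 yx12 y12 xy2.
Qed.

End Collinearity.

Lemma continuous_row (R : realType) (T : topologicalType) d (h : T -> 'I_d -> R) :
  (forall l, continuous (h^~ l)) -> continuous (fun x => \row_l h x l : 'rV[R]_d).
Proof.
move=> hc x; apply/cvg_ballP => e e0.
have : \forall z \near x, forall l, ball (h x l) e (h z l).
  by apply: filter_forall => l; apply: (hc l x); exact: nbhsx_ballx.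
by apply: filterS => z hz; split=> // i l; rewrite !mxE.
Qed.

(** * The test map built from two chords, and its zeros *)

Section DifferenceMap.
Variables (R : realType) (I d n : nat) (f : 'rV[R]_d -> 'rV[R]_n).
Local Notation V := 'rV[R]_I.+1.
Local Notation W := 'rV[R]_(d + d).+1.
Implicit Types (v : V) (w : W).

Definition extend v : 'rV[R]_d := \row_l (if (l <= I)%N then v 0 (inord l) else 0).
Definition low w : 'rV[R]_d := \row_l w 0 (inord l).
Definition mid w : 'rV[R]_d := \row_l w 0 (inord (d + l)).
Definition top w : R := w 0 ord_max.

(** With midpoint and half-difference as parameters, swapping the endpoints is [u -> - u]. *)
Definition chord (c u : 'rV[R]_d) : 'rV[R]_n := f (c + u) - f (c - u).

(* v and w encode the pairs (c + u, c - u) and (- c + u', - c - u') with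
   c = mid w, u = extend v + low w / 2 and u' = extend v - low w / 2. *)
Definition chord_comb (x : V * W) : 'rV[R]_n :=
  ((1 + top x.2) / 2) *: chord (mid x.2) (extend x.1 + 2^-1 *: low x.2) -
  ((1 - top x.2) / 2) *: chord (- mid x.2) (extend x.1 - 2^-1 *: low x.2).

Lemma chordN c u : chord c (- u) = - chord c u.
Proof. by rewrite /chord opprK opprB. Qed.

Lemma extendN v : extend (- v) = - extend v.
Proof. by apply/rowP => l; rewrite !mxE; case: ifP => _; rewrite ?oppr0. Qed.

Lemma lowN w : low (- w) = - low w.
Proof. by apply/rowP => l; rewrite !mxE. Qed.

Lemma midN w : mid (- w) = - mid w.
Proof. by apply/rowP => l; rewrite !mxE. Qed.

Lemma topN w : top (- w) = - top w.
Proof. by rewrite /top mxE. Qed.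

Lemma low_flip w : low (flip_low w) = - low w.
Proof.
apply/rowP => l; rewrite !mxE inordK ?ltn_ord //.
by rewrite ltnS (leq_trans (ltnW (ltn_ord l))) // leq_addr.
Qed.

Lemma mid_flip w : mid (flip_low w) = mid w.
Proof.
apply/rowP => l; rewrite !mxE inordK; last by rewrite ltnS leq_add2l ltnW.
by rewrite ltnNge leq_addr.
Qed.

Lemma top_flip w : top (flip_low w) = top w.
Proof. by rewrite /top mxE /= ltnNge leq_addr. Qed.

(** Here the two weighted chords trade places. *)
Lemma chord_combNr v w : chord_comb (v, - w) = - chord_comb (v, w).
Proof.
rewrite /chord_comb /= lowN midN topN scalerN !opprK.
by rewrite opprB.
Qed.

(** Here both chords are reversed and the weights are kept. *)
Lemma chord_combN_flip v w : chord_comb (- v, flip_low w) = - chord_comb (v, w).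
Proof.
rewrite /chord_comb /= extendN low_flip mid_flip top_flip scalerN opprK.
have -> : - extend v + 2^-1 *: low w = - (extend v - 2^-1 *: low w).
  by rewrite opprB addrC.
by rewrite -opprD !chordN !scalerN -opprD.
Qed.

Lemma chord_comb_continuous k : continuous f ->
  continuous (fun x => chord_comb x 0 k).
Proof.
move=> fc x.
have extc : continuous extend.
  apply: continuous_row => l; case: (l <= I)%N; last exact: cst_continuous.
  exact: coord_continuous.
have lowc : continuous low by apply: continuous_row => l; exact: coord_continuous.
have midc : continuous mid by apply: continuous_row => l; exact: coord_continuous.
have topc : continuous top by exact: coord_continuous.
have on2 (U : topologicalType) (g : W -> U) :
    continuous g -> continuous (fun y : V * W => g y.2).
  by move=> gc y; apply: (continuous_comp (f := snd)); [exact: cvg_snd|exact: gc].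
have on1 (U : topologicalType) (g : V -> U) :
    continuous g -> continuous (fun y : V * W => g y.1).
  by move=> gc y; apply: (continuous_comp (f := fst)); [exact: cvg_fst|exact: gc].
have chord_cont (c u : V * W -> 'rV[R]_d) : continuous c -> continuous u ->
    continuous (fun y => chord (c y) (u y) 0 k).
  move=> cc uc y; have -> : (fun y => chord (c y) (u y) 0 k) =
      (fun y => f (c y + u y) 0 k - f (c y - u y) 0 k).
    by apply: funext => z; rewrite !mxE.
  have fkc : continuous (fun a => f a 0 k).
    move=> a; apply: (continuous_comp (f := f) (g := fun b : 'rV[R]_n => b 0 k)).
      exact: fc.
    exact: coord_continuous.
  apply: continuousB.
    apply: (continuous_comp (f := fun y => c y + u y)
      (g := fun a => f a 0 k)); last exact: fkc.
    by apply: continuousD; [exact: cc|exact: uc].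
  apply: (continuous_comp (f := fun y => c y - u y)
      (g := fun a => f a 0 k)); last exact: fkc.
  by apply: continuousB; [exact: cc|exact: uc].
have halflow : continuous (fun y : V * W => 2^-1 *: low y.2).
  move=> y; apply: (continuous_comp (f := fun y : V * W => low y.2)); first exact: on2.
  exact: scaler_continuous.
have -> : (fun y => chord_comb y 0 k) = (fun y =>
    (1 + top y.2) / 2 * chord (mid y.2) (extend y.1 + 2^-1 *: low y.2) 0 k -
    (1 - top y.2) / 2 * chord (- mid y.2) (extend y.1 - 2^-1 *: low y.2) 0 k).
  by apply: funext => y; rewrite !mxE.
have cst (r : R) : continuous (fun _ : V * W => r) by exact: cst_continuous.
have c1 : continuous (fun y : V * W => (1 + top y.2) / 2).
  move=> y; exact: (continuousM (continuousD (cst 1 y) (on2 _ _ topc y))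
    (cst 2^-1 y)).
have c2 : continuous (fun y : V * W => (1 - top y.2) / 2).
  move=> y; exact: (continuousM (continuousB (cst 1 y) (on2 _ _ topc y))
    (cst 2^-1 y)).
have mid2 := on2 _ _ midc.
have c3 : continuous (fun y => chord (mid y.2) (extend y.1 + 2^-1 *: low y.2) 0 k).
  apply: chord_cont mid2 _ => y.
  exact: (continuousD (on1 _ _ extc y) (halflow y)).
have c4 : continuous (fun y => chord (- mid y.2) (extend y.1 - 2^-1 *: low y.2) 0 k).
  apply: chord_cont => y; first exact: (continuousN (mid2 y)).
  exact: (continuousB (on1 _ _ extc y) (halflow y)).
exact: (continuousB (continuousM (c1 x) (c3 x)) (continuousM (c2 x) (c4 x))).
Qed.

Lemma l1_norm_extend v : (I < d)%N -> l1_norm (extend v) = l1_norm v.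
Proof.
move=> Id; rewrite /l1_norm.
transitivity (\sum_(l < d | (l < I.+1)%N) `|v 0 (inord l)|).
  rewrite [RHS]big_mkcond; apply: eq_bigr => l _; rewrite mxE ltnS.
  by case: ifP => //; rewrite normr0.
rewrite -(big_ord_widen d (fun l => `|v 0 (inord l)|) Id).
by apply: eq_bigr => l _; rewrite inord_val.
Qed.

Lemma l1_norm_low w : l1_norm (low w) <= l1_norm w.
Proof.
have dd : (d <= (d + d).+1)%N by rewrite ltnW // ltnS leq_addr.
have -> : l1_norm (low w) = \sum_(l < (d + d).+1 | (l < d)%N) `|w 0 (inord l)|.
  rewrite -(big_ord_widen _ (fun l => `|w 0 (inord l)|) dd).
  by apply: eq_bigr => l _; rewrite mxE.
rewrite /l1_norm [leRHS](bigID (fun l : 'I_(d + d).+1 => (l < d)%N)) /=.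
under eq_bigr do rewrite inord_val.
by rewrite lerDl; exact: sumr_ge0.
Qed.

Lemma l1_norm0 q : l1_norm (0 : 'rV[R]_q) = 0.
Proof. by rewrite /l1_norm big1 // => l _; rewrite mxE normr0. Qed.

Lemma l1_normZ q (a : R) (u : 'rV[R]_q) : l1_norm (a *: u) = `|a| * l1_norm u.
Proof.
by rewrite /l1_norm mulr_sumr; apply: eq_bigr => l _; rewrite mxE normrM.
Qed.

Lemma l1_norm_top w : low w = 0 -> mid w = 0 -> l1_norm w = `|top w|.
Proof.
move=> l0 m0; rewrite /l1_norm (bigD1 ord_max) //= big1 ?addr0 // => l lmax.
have l2d : (l < d + d)%N.
  by rewrite ltn_neqAle -ltnS ltn_ord andbT; move: lmax; rewrite -val_eqE.
have [ld|dl] := ltnP l d.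
  have /rowP/(_ (Ordinal ld)) := l0; rewrite !mxE /= inord_val => ->.
  by rewrite normr0.
have lmd : (l - d < d)%N by rewrite ltn_subLR.
have /rowP/(_ (Ordinal lmd)) := m0; rewrite !mxE /= subnKC // inord_val => ->.
by rewrite normr0.
Qed.

(** This is the reason for the factor 1/2 in [chord_comb]: [extend v] has norm 1 and [low w] norm at
    most 1, so they cannot cancel. *)
Lemma extend_low_neq0 v w (a : R) : (I < d)%N -> l1_sphere v -> l1_sphere w ->
  `|a| < 1 -> extend v + a *: low w != 0.
Proof.
move=> Id v1 w1 a1; apply/eqP => /eqP; rewrite addr_eq0 -scaleNr => /eqP e.
have : l1_norm (extend v) <= `|a| * 1.
  by rewrite e l1_normZ normrN ler_wpM2l // -(w1 : l1_norm w = 1) l1_norm_low.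
by rewrite l1_norm_extend // (v1 : l1_norm v = 1) mulr1 leNgt a1.
Qed.

Lemma chord_comb_zero v w : injective f -> (I < d)%N ->
  l1_sphere v -> l1_sphere w -> chord_comb (v, w) = 0 ->
  inscribes_trapezoid f \/ maps_three_to_line f.
Proof.
move=> f_inj Id v1 w1 /eqP; rewrite /chord_comb /= subr_eq0 => /eqP.
have half1 : `|2^-1 : R| < 1 by rewrite ger0_norm; lra.
have u1 := extend_low_neq0 Id v1 w1 half1.
have u2 : extend v - 2^-1 *: low w != 0.
  by rewrite -scaleNr extend_low_neq0 // normrN.
have ends_neq (c u : 'rV[R]_d) : u != 0 -> c + u != c - u.
  apply: contraNneq => /addrI/eqP; rewrite -addr_eq0 -mulr2n -scaler_nat.
  by rewrite scaler_eq0 pnatr_eq0.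
have chord_neq0 c u : u != 0 -> chord c u != 0.
  by move=> /(ends_neq c); rewrite subr_eq0 (inj_eq f_inj).
set p := chord _ _; set q := chord _ _ => pq.
have p0 : p != 0 by exact: chord_neq0.
have q0 : q != 0 by exact: chord_neq0.
have [t1 t2] : -1 <= top w /\ top w <= 1.
  by apply/andP; rewrite -ler_norml; exact: l1_sphere_le1.
(* At [top w = -1] or [top w = 1] only one chord would remain, and it is nonzero; so both weights
   are positive. *)
have t1' : -1 < top w.
  rewrite lt_neqAle t1 andbT; apply: contra_neq q0 => tw.
  by move: pq; rewrite -tw subrr mul0r scale0r opprK divff ?pnatr_eq0 // scale1r.
have t2' : top w < 1.
  rewrite lt_neqAle t2 andbT; apply: contra_neq p0 => tw.
  by move: pq; rewrite tw subrr mul0r scale0r divff ?pnatr_eq0 // scale1r.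
apply: (trapezoid_or_line f_inj _ _ _ _ _ _ pq); try exact: ends_neq.
(* Equal pairs force [mid w = 0] and [low w = 0], hence [top w] has absolute value 1. *)
- apply/eqP => -[/rowP e1 /rowP e2].
  have m0 : mid w = 0.
    by apply/rowP => l; move: (e1 l) (e2 l); rewrite !mxE; lra.
  have l0 : low w = 0.
    by apply/rowP => l; move: (e1 l) (e2 l); rewrite !mxE; lra.
  have := l1_norm_top l0 m0; rewrite (w1 : l1_norm w = 1) => /esym.
  by apply/eqP; rewrite lt_eqF // ltr_norml t1' t2'.
(* Reversed pairs force the half-differences to be opposite, so their sum [2 * extend v]
   vanishes. *)
- apply/eqP => -[/rowP e1 /rowP e2].
  have e0 : extend v = 0.
    by apply/rowP => l; move: (e1 l) (e2 l); rewrite !mxE; lra.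
  have := l1_norm_extend v Id; rewrite e0 l1_norm0 (v1 : l1_norm v = 1).
  by move/eqP; rewrite eq_sym oner_eq0.
- by rewrite divr_gt0 // -ltrBlDl sub0r.
- by rewrite divr_gt0 // subr_gt0.
Qed.

End DifferenceMap.

Theorem theorem3 (R : realType) (d n : nat) (hd : (1 <= d)%N)
    (hn : (n <= 2 * d + 2 ^ gamma d - 1)%N)
    (f : 'rV[R]_d -> 'rV[R]_n) (hf : embedding f) :
  inscribes_trapezoid f \/ maps_three_to_line f.
Proof.
have [f_inj f_cont _] := hf.
have /dvdnP[m dm] := pow2_gamma_dvd hd.
have K0 : (0 < 2 ^ gamma d)%N by rewrite expn_gt0.
(* The dimension of the sphere of [v] in the space of dimension [2 ^ gamma d], which embeds in that
   of dimension [d] by divisibility. *)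
set I := (2 ^ gamma d).-1.
have Id : (I < d)%N by rewrite prednK // dvdn_leq // pow2_gamma_dvd.
have odd_bin : odd 'C(I + d, I) by rewrite [X in (I + X)%N]dm mulnC odd_bin_pow2.
have n_le : (n <= I + (d + d))%N by rewrite /I; lia.
have [v [w [v1 w1 Fvw]]] := borsuk_ulam hd n_le odd_bin
  (fun k => @chord_comb_continuous R I d n f k f_cont) (chord_combNr f)
  (chord_combN_flip (I := I) f).
exact: chord_comb_zero f_inj Id v1 w1 Fvw.
Qed.
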